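(* For the stochastic multisymplectic system $$M_{\alpha\beta}\,dz^\beta+K^i_{\alpha\beta}z^\beta_{,i}\,dt+\widetilde K^i_{\alpha\beta}z^\beta_{,i}\circ dW_t=\frac{\partial H}{\partial z^\alpha}\,dt+\frac{\partial \widetilde H}{\partial z^\alpha}\circ dW_t,\qquad \alpha=1,\dots,m,$$ the $1$-forms $L^0_\alpha\,\mathbf d z^\alpha$, $L^i_\alpha\,\mathbf d z^\alpha$ and $\widetilde L^i_\alpha\,\mathbf d z^\alpha$ satisfy the stochastic $1$-form quasi-conservation law $$d\big(L^0_\alpha\,\mathbf d z^\alpha\big)+\big(L^i_\alpha\,\mathbf d z^\alpha\,dt+\widetilde L^i_\alpha\,\mathbf d z^\alpha\circ dW_t\big)_{,i}=\mathbf d\big(L^0_\alpha\,dz^\alpha+L^i_\alpha z^\alpha_{,i}\,dt+\widetilde L^i_\alpha z^\alpha_{,i}\circ dW_t-H\,dt-\widetilde H\circ dW_t\big).$$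
   Context: Let $x=(x^1,\dots,x^n)$ be the spatial coordinates and $t$ time; a subscript ${}_{,i}$ denotes the total derivative with respect to $x^i$. Repeated spatial indices are summed over $1,\dots,n$ (time excluded) and repeated Greek indices over $1,\dots,m$. Let $W$ be a one-dimensional Brownian motion on a probability space; all components of the dependent variable $z=(z^1,\dots,z^m)$ are adapted to the filtration generated by $W$. The symbol $d$ (not bold) is the stochastic time increment, and $\circ\,dW_t$ denotes stochastic integration in the Stratonovich sense, so that the standard product and chain rules apply. The bold symbol $\mathbf d$ is the exterior derivative in the dependent variables $z^\alpha$ (and their derivatives), as opposed to the time increment $d$. The law is obtained by a formal direct calculation. $L^0_\alpha(z),\ L^i_\alpha(z),\ \widetilde L^i_\alpha(z),\ H(z),\ \widetilde H(z)$ are given functions of $z$ ($i=1,\dots,n$, $\alpha=1,\dots,m$), and $$M_{\alpha\beta}=\frac{\partial L^0_\beta}{\partial z^\alpha}-\frac{\partial L^0_\alpha}{\partial z^\beta},\quad K^i_{\alpha\beta}=\frac{\partial L^i_\beta}{\partial z^\alpha}-\frac{\partial L^i_\alpha}{\partial z^\beta},\quad \widetilde K^i_{\alpha\beta}=\frac{\partial \widetilde L^i_\beta}{\partial z^\alpha}-\frac{\partial \widetilde L^i_\alpha}{\partial z^\beta}$$ are skew-symmetric. The system is the Euler–Lagrange system of the stochastic action $\int\int_{t_0}^{t_1}\big[L^0_\alpha\,dz^\alpha+L^i_\alpha z^\alpha_{,i}\,dt+\widetilde L^i_\alpha z^\alpha_{,i}\circ dW_t-H\,dt-\widetilde H\circ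 dW_t\big]\,dx^1\wedge\cdots\wedge dx^n$. *)

(* Defs.v *)
From mathcomp Require Import all_boot all_order all_algebra.
From mathcomp Require Import all_classical all_reals all_analysis.

Set Implicit Arguments.
Unset Strict Implicit.
Unset Printing Implicit Defensive.

Import Order.TTheory GRing.Theory Num.Theory.
Import numFieldNormedType.Exports.

Local Open Scope classical_set_scope.
Local Open Scope ring_scope.

(* 'e_j is the j-th unit row vector, so 'D_('e_j) f z is the partial
   derivative of f with respect to the j-th coordinate at z. *)

Section Functions.
Context {R : realType} {k : nat}.

Fixpoint Ck (r : nat) (F : 'rV[R]_k -> R) : Prop :=
  if r is r'.+1 then
    (forall v, differentiable F v) /\
    (forall j : 'I_k, Ck r' (fun v => 'D_('e_j) F v))
  else continuous F.

Definition smooth (F : 'rV[R]_k -> R) : Prop := forall r, Ck r F.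

(* The skew matrices M, K^i and \tilde K^i are curl L^0, curl L^i and
   curl \tilde L^i. *)
Definition curl (A : 'I_k -> 'rV[R]_k -> R) (a b : 'I_k) (v : 'rV[R]_k) : R :=
  'D_('e_a) (A b) v - 'D_('e_b) (A a) v.

End Functions.

Definition process (R : realType) (T : Type) := R -> T -> R.

Section Processes.
Context {R : realType} {d : measure_display} {T : measurableType d}.
Variable P : probability T R.
Implicit Types (W X Y : process R T).

Definition natural_filtration W (t : R) : set (set T) :=
  <<s [set A | exists u, exists B : set R,
         [/\ 0 <= u <= t, measurable B & A = W u @^-1` B]] >>.

Record brownian_motion W : Prop := {
  brownian_measurable : forall t : R, 0 <= t -> measurable_fun setT (W t) ;
  brownian_start : {ae P, forall w, W 0 w = 0} ;
  brownian_normal : forall (s t : R) (B : set R),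
    0 <= s -> s < t -> measurable B ->
    P ((W t \- W s) @^-1` B) = normal_prob 0 (Num.sqrt (t - s)) B ;
  brownian_independent : forall (s t : R) (A : set T) (B : set R),
    0 <= s -> s < t -> natural_filtration W s A -> measurable B ->
    P (A `&` (W t \- W s) @^-1` B) = (P A * P ((W t \- W s)%R @^-1` B))%E ;
  brownian_continuous :
    {ae P, forall w, {within [set t : R | 0 <= t], continuous (W ^~ w)}} }.

(* Adapted to the filtration generated by W completed with the P-null sets:
   X t is almost surely equal to a variable measurable for that filtration. *)
Definition adapted_at W X (t : R) : Prop :=
  measurable_fun setT (X t) /\
  exists2 Y : T -> R,
    (forall B : set R, measurable B -> natural_filtration W t (Y @^-1` B)) &
    {ae P, forall w, X t w = Y w}.

(* A partition t0 < s_1 < ... < s_N = t is encoded by [:: s_1; ...; s_N],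
   so that the k-th subinterval is [pt t0 s k, pt t0 s k.+1]. *)
Definition pt (t0 : R) (s : seq R) (k : nat) : R := nth t0 (t0 :: s) k.

Definition mesh_lt (t0 : R) (s : seq R) (delta : R) : Prop :=
  forall k, (k < size s)%N -> pt t0 s k.+1 - pt t0 s k < delta.

Definition stratonovich_sum (t0 : R) Y X (s : seq R) (w : T) : R :=
  \sum_(k < size s)
    (Y (pt t0 s k) w + Y (pt t0 s k.+1) w) / 2 *
    (X (pt t0 s k.+1) w - X (pt t0 s k) w).

Definition is_stratonovich (t0 : R) Y X (t : R) (I : T -> R) : Prop :=
  measurable_fun setT I /\
  forall eps eta : R, 0 < eps -> 0 < eta ->
    exists2 delta : R, 0 < delta &
      forall s, itv_partition t0 t s -> mesh_lt t0 s delta ->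
        (P [set w | (eps <= `|stratonovich_sum t0 Y X s w - I w|)%R]
          <= eta%:E)%E.

(* The process t |-> \int_{t0}^t Y \circ dX; the limit in probability is only
   determined almost surely, and a representative is chosen. *)
Definition stratonovich (t0 : R) Y X : process R T :=
  fun t => xget (fun=> 0) [set I | is_stratonovich t0 Y X t I].

Definition time_process : process R T := fun t _ => t.

(* The rules of Stratonovich calculus on [t0, t1], for a class S of processes
   adapted to the filtration of W; the processes which are modifications of
   continuous semimartingales are the standard example. The rule
   d(XY) = X \circ dY + Y \circ dX is not listed since it already holds for the
   sums defining the integral. *)
Record stratonovich_class (t0 t1 : R) W (S : set (process R T)) : Prop := {
  strat_adapted : forall X, S X ->
    forall t : R, t0 <= t <= t1 -> adapted_at W X t ;
  strat_time : S time_process ;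
  strat_brownian : S W ;
  strat_cst : forall c : R, S (fun _ _ => c) ;
  strat_add : forall X Y, S X -> S Y -> S (fun t w => X t w + Y t w) ;
  strat_mul : forall X Y, S X -> S Y -> S (fun t w => X t w * Y t w) ;
  strat_smooth : forall k (F : 'rV[R]_k -> R) (X : 'I_k -> process R T),
    smooth F -> (forall j, S (X j)) -> S (fun t w => F (\row_j X j t w)) ;
  strat_integrable : forall X Y, S X -> S Y ->
    forall t : R, t0 <= t <= t1 -> exists I, is_stratonovich t0 Y X t I ;
  strat_integral : forall X Y, S X -> S Y -> S (stratonovich t0 Y X) ;
  (* dF(X) = \partial_j F(X) \circ dX^j *)
  strat_chain : forall k (F : 'rV[R]_k -> R) (X : 'I_k -> process R T),
    smooth F -> (forall j, S (X j)) -> forall t : R, t0 <= t <= t1 ->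
    {ae P, forall w,
       F (\row_j X j t w) - F (\row_j X j t0 w) =
       \sum_j stratonovich t0
                (fun s w' => 'D_('e_j) F (\row_l X l s w')) (X j) t w} ;
  (* Y \circ (Z \circ dX) = (Y Z) \circ dX *)
  strat_assoc : forall X Y Z, S X -> S Y -> S Z ->
    forall t : R, t0 <= t <= t1 ->
    {ae P, forall w,
       stratonovich t0 Y (stratonovich t0 Z X) t w =
       stratonovich t0 (fun s w' => Y s w' * Z s w') X t w} }.

End Processes.

(* A formal stochastic differential \sum_k F_k \circ dG_k is the list of its
   pairs (F_k, G_k); sums are concatenations. *)
Definition sdiff (A : Type) := seq (A * A).

Notation "F '\od' G" := [:: (F, G)] (at level 45, no associativity).
Notation "\dsum_ ( i < n ) E" := (\big[cat/[::]]_(i < n) E)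
  (at level 36, E at level 55, i, n at level 50).

Section Fields.
Context {R : realType} {d : measure_display} {T : measurableType d}.
Context {n m : nat}.

(* x |-> t |-> w |-> value *)
Definition sfield := 'rV[R]_n -> process R T.
Definition field := 'rV[R]_n -> R -> T -> 'rV[R]_m.

Definition functional := field -> sfield.

(* A 1-form on the space of fields, given by its values on the tangent
   vectors zeta (variations of the field) at z; the operators d and _{,i} act on
   a 1-form by acting on its value at a fixed zeta. *)
Definition oneform := field -> field -> sfield.

Definition const_field (X : process R T) : sfield := fun=> X.

Definition total_deriv (i : 'I_n) (f : sfield) : sfield :=
  fun x t w => 'D_('e_i) (fun y => f y t w) x.

Definition component (a : 'I_m) : functional := fun z x t w => z x t w 0 a.

Definition jet (i : 'I_n) (a : 'I_m) : functional :=
  fun z => total_deriv i (component a z).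

Definition subst (F : 'rV[R]_m -> R) : functional := fun z x t w => F (z x t w).

Definition fmul (F G : functional) : functional :=
  fun z x t w => F z x t w * G z x t w.

Definition fopp (F : functional) : functional := fun z x t w => - F z x t w.

Definition fconst (X : process R T) : functional := fun=> const_field X.

(* The exterior derivative in the dependent variables: the variation of F at z
   in the direction zeta, x, t and the sample point being fixed. *)
Definition vd (F : functional) : oneform := fun z zeta x t w =>
  derive1 (fun e : R => F (fun y s w' => z y s w' + e *: zeta y s w') x t w) 0.

(* The 1-form A_a(z) \mathbf d z^a *)
Definition canonical_form (A : 'I_m -> 'rV[R]_m -> R) : oneform :=
  fun z zeta x t w =>
    \sum_a subst (A a) z x t w * vd (component a) z zeta x t w.

Definition eval_sdiff (Theta : sdiff functional) (z : field) : sdiff sfield :=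
  [seq (p.1 z, p.2 z) | p <- Theta].

Definition time_diff (f : sfield) : sdiff sfield :=
  const_field (fun _ _ => 1) \od f.

(* The operators _{,i} and \mathbf d are derivations that commute with d:
   (F \circ dG)_{,i} = F_{,i} \circ dG + F \circ d(G_{,i}),
   \mathbf d (F \circ dG) = \mathbf d F \circ dG + F \circ d(\mathbf d G).
   The derivatives of t and W, as fields, are 0. *)
Definition total_deriv_sdiff (i : 'I_n) (D : sdiff sfield) : sdiff sfield :=
  flatten [seq (total_deriv i p.1 \od p.2) ++ (p.1 \od total_deriv i p.2)
          | p <- D].

Definition vd_sdiff (Theta : sdiff functional) (z zeta : field) :
    sdiff sfield :=
  flatten [seq (vd p.1 z zeta \od p.2 z) ++ (p.1 z \od vd p.2 z zeta)
          | p <- Theta].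

Section Equations.
Variables (P : probability T R) (t0 t1 : R).

Definition integrate (D : sdiff sfield) (x : 'rV[R]_n) : process R T :=
  fun t w => \sum_(p <- D) stratonovich P t0 (p.1 x) (p.2 x) t w.

(* Equality of stochastic differentials on [t0, t1], at every point x. *)
Definition sdiff_eq (D E : sdiff sfield) : Prop :=
  forall x (t : R), t0 <= t <= t1 ->
    {ae P, forall w, integrate D x t w = integrate E x t w}.

(* Fields, and variations of fields, that are differentiable in x and whose
   components and their first spatial derivatives belong to the class S. *)
Definition admissible (S : set (process R T)) (z : field) : Prop :=
  (forall x (t : R) w, t0 <= t <= t1 -> differentiable (fun y => z y t w) x) /\
  (forall x a, S (component a z x) /\ forall i, S (jet i a z x)).

Variables (W : process R T).
Variables (L0 : 'I_m -> 'rV[R]_m -> R) (L Lt : 'I_n -> 'I_m -> 'rV[R]_m -> R).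
Variables (H Ht : 'rV[R]_m -> R).

Definition lagrangian : sdiff functional :=
     \dsum_(a < m) (subst (L0 a) \od component a)
  ++ \dsum_(i < n) \dsum_(a < m)
       (fmul (subst (L i a)) (jet i a) \od fconst time_process)
  ++ \dsum_(i < n) \dsum_(a < m)
       (fmul (subst (Lt i a)) (jet i a) \od fconst W)
  ++ (fopp (subst H) \od fconst time_process)
  ++ (fopp (subst Ht) \od fconst W).

Definition multisymplectic_lhs (a : 'I_m) : sdiff functional :=
     \dsum_(b < m) (subst (curl L0 a b) \od component b)
  ++ \dsum_(i < n) \dsum_(b < m)
       (fmul (subst (curl (L i) a b)) (jet i b) \od fconst time_process)
  ++ \dsum_(i < n) \dsum_(b < m)
       (fmul (subst (curl (Lt i) a b)) (jet i b) \od fconst W).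

Definition multisymplectic_rhs (a : 'I_m) : sdiff functional :=
     (subst (fun v => 'D_('e_a) H v) \od fconst time_process)
  ++ (subst (fun v => 'D_('e_a) Ht v) \od fconst W).

Definition multisymplectic_system (z : field) : Prop :=
  forall a : 'I_m, sdiff_eq (eval_sdiff (multisymplectic_lhs a) z)
                            (eval_sdiff (multisymplectic_rhs a) z).

Definition flux (i : 'I_n) (z zeta : field) : sdiff sfield :=
     (canonical_form (L i) z zeta \od const_field time_process)
  ++ (canonical_form (Lt i) z zeta \od const_field W).

Definition quasi_conservation_law (S : set (process R T)) (z : field) : Prop :=
  forall zeta : field, admissible S zeta ->
    sdiff_eq (time_diff (canonical_form L0 z zeta)
              ++ \dsum_(i < n) total_deriv_sdiff i (flux i z zeta))
             (vd_sdiff lagrangian z zeta).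

End Equations.
End Fields.

Arguments field R {d} T n m.

(* Main.v *)
(** The Stratonovich integral is bilinear and satisfies the product rule up to
    null sets, since its defining sums do and limits in probability are almost
    surely unique; together with the chain rule and associativity assumed of
    the class [S], every term of the law becomes a sum of integrals against the
    drivers [z^b], time and [W]. Driver by driver, the two sides of the law
    then differ by the integrals of [zeta^a curl A a b z^b_{,i}] and
    [zeta^a 'D_('e_a) H], that is, by the system contracted with [zeta^a]. *)

Require Import Defs.
From mathcomp Require Import all_boot all_order all_algebra.
From mathcomp Require Import all_classical all_reals all_analysis.
From mathcomp Require Import measurable_realfun ring lra.

Set Implicit Arguments.
Unset Strict Implicit.
Unset Printing Implicit Defensive.

Import Order.TTheory GRing.Theory Num.Theory.
Import numFieldNormedType.Exports.

Local Open Scope classical_set_scope.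
Local Open Scope ring_scope.

(** * Smooth functions and their partial derivatives *)

Section Smooth.
Context {R : realType} {k : nat}.
Implicit Types F : 'rV[R]_k -> R.

Lemma smooth_differentiable F v : smooth F -> differentiable F v.
Proof. by move=> sF; have [+ _] := sF 1%N; exact. Qed.

Lemma smooth_partial F j : smooth F -> smooth (fun v => 'D_('e_j) F v).
Proof. by move=> sF r; have [_] := sF r.+1; exact. Qed.

End Smooth.

(** * Partitions of arbitrarily small mesh *)

Section Partitions.
Context {R : realType}.
Implicit Types (t : R) (s : seq R).

(** A limit as the mesh tends to 0 would be vacuous without fine partitions. The uniform one works:
    [N] exceeds [(t - t0) / delta], so its step [h] is below [delta]; for [t = t0] the empty list
    serves. *)
Lemma fine_partition t0 t delta : t0 <= t -> 0 < delta ->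
  exists s, itv_partition t0 t s /\ mesh_lt t0 s delta.
Proof.
rewrite le_eqVlt => /predU1P[<- _|t0t delta0].
  by exists [::]; split=> //; split.
pose N := (Num.truncn ((t - t0) / delta)).+1.
have N0 : 0 < N%:R :> R by rewrite ltr0n.
pose h := (t - t0) / N%:R.
have h0 : 0 < h by rewrite divr_gt0 ?subr_gt0.
have hdelta : h < delta.
  by rewrite ltr_pdivrMr// mulrC -ltr_pdivrMr// truncnS_gt.
pose s := mkseq (fun i => t0 + h * i.+1%:R) N.
have sN : size s = N by rewrite size_mkseq.
have ptE k : (k <= N)%N -> pt t0 s k = t0 + h * k%:R.
  by case: k => [|k] kN; rewrite /pt/= ?mulr0 ?addr0// nth_mkseq.
exists s; split; first split.
- apply/(pathP t0) => i; rewrite sN => iN.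
  have -> : nth t0 (t0 :: s) i = t0 + h * i%:R by apply: ptE; exact: ltnW.
  by rewrite nth_mkseq// ltrD2l ltr_pM2l// ltr_nat.
- by rewrite -nth_last sN nth_mkseq//= /h -/N divfK ?lt0r_neq0// addrC subrK.
- move=> k; rewrite sN => kN; rewrite !ptE//; last exact: ltnW.
  by rewrite opprD addrACA subrr add0r -mulrBr -natrB// subSnn mulr1.
Qed.

Lemma pt_itv t0 t s k : itv_partition t0 t s -> (k <= size s)%N ->
  t0 <= pt t0 s k <= t.
Proof.
move=> hs ks.
(* The default of [nth] is never reached when [k <= size s]; replacing [t0] by [t] gives the form in
   which bounds on partition points are stated. *)
rewrite /pt (set_nth_default t)//= (itv_partition_nth_ge _ hs)//.
exact: itv_partition_nth_le.
Qed.

Lemma pt_last t0 t s : itv_partition t0 t s -> pt t0 s (size s) = t.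
Proof. by case=> _ /eqP <-; rewrite /pt -last_nth. Qed.

End Partitions.

(** * Limits in probability along partitions *)

Section MeshLimit.
Context {R : realType} {d : measure_display} {T : measurableType d}.
Variables (P : probability T R) (t0 : R).
Implicit Types (X Y Z : process R T) (sigma : seq R -> T -> R) (I : T -> R).

(** The convergence clause of [is_stratonovich], for an arbitrary functional [sigma] of the
    partition: the product rule applies it to a constant one. *)
Definition mesh_limit (t : R) sigma I : Prop :=
  forall eps eta : R, 0 < eps -> 0 < eta ->
    exists2 delta : R, 0 < delta &
      forall s, itv_partition t0 t s -> mesh_lt t0 s delta ->
        (P [set w | (eps <= `|sigma s w - I w|)%R] <= eta%:E)%E.

Lemma measurable_deviation (f g : T -> R) (eps : R) :
  measurable_fun setT f -> measurable_fun setT g ->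
  measurable [set w | eps <= `|f w - g w|].
Proof.
move=> mf mg; rewrite -[X in measurable X]setTI.
apply: measurable_fun_le => //.
by apply: measurableT_comp => //; exact: measurable_funB.
Qed.

(** Almost sure uniqueness of limits in probability. On one fine partition, a gap of at least [eps]
    between [I] and [I1 + I2] forces one of the three sums to miss its limit by [eps / 3], up to the
    null set where the sums are not additive. *)
Lemma mesh_limitD (t : R) sigma sigma1 sigma2 I I1 I2 : t0 <= t ->
  (forall s, itv_partition t0 t s -> measurable_fun setT (sigma s)) ->
  (forall s, itv_partition t0 t s -> measurable_fun setT (sigma1 s)) ->
  (forall s, itv_partition t0 t s -> measurable_fun setT (sigma2 s)) ->
  measurable_fun setT I -> measurable_fun setT I1 -> measurable_fun setT I2 ->
  mesh_limit t sigma I -> mesh_limit t sigma1 I1 -> mesh_limit t sigma2 I2 ->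
  (forall s, itv_partition t0 t s ->
    {ae P, forall w, sigma s w = sigma1 s w + sigma2 s w}) ->
  {ae P, forall w, I w = I1 w + I2 w}.
Proof.
move=> t0t msigma msigma1 msigma2 mI mI1 mI2 lI lI1 lI2 sigmaE.
have mI12 : measurable_fun setT (fun w => I1 w + I2 w).
  exact: measurable_funD.
have PU A B : measurable A -> measurable B -> (P (A `|` B) <= P A + P B)%E.
  exact: measureU2.
have dev0 eps : 0 < eps ->
    P.-negligible [set w | eps <= `|I w - (I1 w + I2 w)|].
  move=> eps0; apply/negligibleP; first exact: measurable_deviation.
  (* The deviation set does not depend on the partition, so a bound by every [eta > 0] makes it
     null. *)
  apply/eqP; rewrite -measure_le0; apply/lee_addgt0Pr => eta eta0.
  rewrite add0e.
  have e30 : 0 < eps / 3 by lra.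
  have h30 : 0 < eta / 3 by lra.
  have [d0 d00 l0] := lI _ _ e30 h30.
  have [d1 d10 l1] := lI1 _ _ e30 h30.
  have [d2 d20 l2] := lI2 _ _ e30 h30.
  have delta0 : 0 < Num.min d0 (Num.min d1 d2) by rewrite !lt_min d00 d10.
  have [s [hs mesh_s]] := fine_partition t0t delta0.
  have mesh_s' d' : Num.min d0 (Num.min d1 d2) <= d' -> mesh_lt t0 s d'.
    by move=> h k ks; exact: lt_le_trans (mesh_s k ks) h.
  have {}l0 := l0 s hs (mesh_s' _ _).
  have {}l1 := l1 s hs (mesh_s' _ _).
  have {}l2 := l2 s hs (mesh_s' _ _).
  (* [B] is the exceptional null set of this particular partition; a single partition is enough. *)
  have [B [mB PB0 sB]] := sigmaE s hs.
  set A0 := [set w | _] in l0; set A1 := [set w | _] in l1.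
  set A2 := [set w | _] in l2.
  have mA0 : measurable A0 by apply: measurable_deviation => //; exact: msigma.
  have mA1 : measurable A1 by apply: measurable_deviation => //; exact: msigma1.
  have mA2 : measurable A2 by apply: measurable_deviation => //; exact: msigma2.
  apply: (@le_trans _ _ (P (((A0 `|` A1) `|` A2) `|` B))).
    apply: le_measure; rewrite ?inE.
    - exact: measurable_deviation.
    - by do 3 apply: measurableU => //.
    move=> w /= Iw; apply: contrapT.
    move=> /not_orP[/not_orP[/not_orP[n0 n1] n2] nB].
    have sE : sigma s w = sigma1 s w + sigma2 s w.
      by apply: contrapT => h; exact/nB/sB.
    move: n0 n1 n2 Iw; rewrite /A0 /A1 /A2 /=.
    move=> /negP; rewrite -ltNge ltr_norml => /andP[a0 b0].
    move=> /negP; rewrite -ltNge ltr_norml => /andP[a1 b1].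
    move=> /negP; rewrite -ltNge ltr_norml => /andP[a2 b2].
    by rewrite leNgt ltr_norml => /negP; apply; apply/andP; split; lra.
  apply: le_trans (PU _ _ _ mB) _; first by do 2 apply: measurableU => //.
  rewrite PB0 adde0.
  apply: le_trans (PU _ _ _ mA2) _; first exact: measurableU.
  have -> : eta%:E = ((eta / 3)%:E + (eta / 3)%:E + (eta / 3)%:E)%E.
    by rewrite -!EFinD; congr EFin; lra.
  apply: leeD; last by apply: l2; rewrite !ge_min lexx !orbT.
  apply: le_trans (PU _ _ mA0 mA1) _; apply: leeD.
    by apply: l0; rewrite !ge_min lexx.
  by apply: l1; rewrite !ge_min lexx !orbT.
(* The set where the two sides differ is the countable union of the deviation sets for
   [eps = 1 / (k + 1)]. *)
have dev0V (k : nat) := dev0 k.+1%:R^-1 ltac:(by rewrite invr_gt0).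
have := negligible_bigcup dev0V.
apply: negligibleS => w /= /eqP; rewrite -subr_eq0 -normr_gt0 => Iw.
exists (Num.truncn `|I w - (I1 w + I2 w)|^-1) => //=.
by rewrite invf_ple ?posrE// ltW// truncnS_gt.
Qed.

End MeshLimit.

(** * Stratonovich calculus in the class [S] *)

Section StratonovichClass.
Context {R : realType} {d : measure_display} {T : measurableType d}.
Variables (P : probability T R) (t0 t1 : R) (W : process R T).
Variable S : set (process R T).
Hypothesis hS : stratonovich_class P t0 t1 W S.
Implicit Types X Y Z : process R T.

Local Notation J := (stratonovich P t0).

Lemma process_ext X Y : (forall t w, X t w = Y t w) -> X = Y.
Proof. by move=> XY; apply/funext => t; apply/funext => w. Qed.

Lemma class0 : S (fun _ _ => 0).
Proof. exact: (strat_cst hS 0). Qed.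

Lemma classN X : S X -> S (fun t w => - X t w).
Proof.
move=> SX; have := strat_mul hS (strat_cst hS (-1)) SX.
by congr S; apply/funext => t; apply/funext => w; rewrite mulN1r.
Qed.

Lemma classB X Y : S X -> S Y -> S (fun t w => X t w - Y t w).
Proof. by move=> SX SY; exact: (strat_add hS SX (classN SY)). Qed.

Lemma class_sum (A : Type) (r : seq A) (X : A -> process R T) :
  (forall i, S (X i)) -> S (fun t w => \sum_(i <- r) X i t w).
Proof.
move=> SX; elim: r => [|i r ih].
  by under eq_fun do under eq_fun do rewrite big_nil; exact: class0.
under eq_fun do under eq_fun do rewrite big_cons.
exact: (strat_add hS (SX i) ih).
Qed.

Lemma measurable_class X t : S X -> t0 <= t <= t1 -> measurable_fun setT (X t).
Proof. by move=> SX ht; have [] := strat_adapted hS SX ht. Qed.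

Lemma pt_class_itv t s k : t0 <= t <= t1 -> itv_partition t0 t s ->
  (k <= size s)%N -> t0 <= pt t0 s k <= t1.
Proof.
move=> /andP[_ tt1] hs ks; have /andP[-> h] := pt_itv hs ks.
exact: le_trans h tt1.
Qed.

Lemma measurable_stratonovich_sum X Y t s : S X -> S Y -> t0 <= t <= t1 ->
  itv_partition t0 t s -> measurable_fun setT (stratonovich_sum t0 Y X s).
Proof.
move=> SX SY ht hs; apply: measurable_sum => k.
have hk := pt_class_itv ht hs (ltnW (ltn_ord k)).
have hk1 := pt_class_itv ht hs (ltn_ord k).
apply: measurable_funM; last first.
  by apply: measurable_funB; exact: measurable_class.
apply: measurable_funM; last exact: measurable_cst.
by apply: measurable_funD; exact: measurable_class.
Qed.

Lemma stratonovichP X Y t : S X -> S Y -> t0 <= t <= t1 ->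
  is_stratonovich P t0 Y X t (J Y X t).
Proof.
move=> SX SY ht; apply: (xgetPex (fun=> 0)).
exact: (strat_integrable hS SX SY ht).
Qed.

(** The sums sample the processes only at partition points, which lie in [[t0, t1]]. The two
    predicates given to [xget] are then equal, hence so are the chosen representatives. This matters
    because fields are differentiable in space only at times in [[t0, t1]]. *)
Lemma eq_stratonovich X X' Y Y' :
  (forall t w, t0 <= t <= t1 -> Y t w = Y' t w) ->
  (forall t w, t0 <= t <= t1 -> X t w = X' t w) ->
  forall t, t0 <= t <= t1 -> J Y X t = J Y' X' t.
Proof.
move=> YY' XX' t ht; rewrite /stratonovich; congr xget.
have sumE s w : itv_partition t0 t s ->
    stratonovich_sum t0 Y X s w = stratonovich_sum t0 Y' X' s w.
  move=> hs; apply: eq_bigr => k _.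
  have hk := pt_class_itv ht hs (ltnW (ltn_ord k)).
  have hk1 := pt_class_itv ht hs (ltn_ord k).
  by rewrite !YY' ?XX'.
apply/seteqP; split=> I /= [mI lI]; split=> // eps eta eps0 eta0;
  have [delta delta0 hdelta] := lI _ _ eps0 eta0; exists delta => // s hs ms;
  (apply: le_trans (hdelta s hs ms); rewrite le_eqVlt; apply/orP; left;
   apply/eqP; congr (P _); apply/seteqP; split=> w /=; by rewrite sumE).
Qed.

(** The common source of additivity in the integrand and in the integrator, and of the comparison of
    integrators below. *)
Lemma stratonovich_sumD X Y X1 Y1 X2 Y2 t :
  S X -> S Y -> S X1 -> S Y1 -> S X2 -> S Y2 -> t0 <= t <= t1 ->
  (forall s, itv_partition t0 t s ->
    {ae P, forall w, stratonovich_sum t0 Y X s w =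
      stratonovich_sum t0 Y1 X1 s w + stratonovich_sum t0 Y2 X2 s w}) ->
  {ae P, forall w, J Y X t w = J Y1 X1 t w + J Y2 X2 t w}.
Proof.
move=> SX SY SX1 SY1 SX2 SY2 ht sumE; have /andP[t0t _] := ht.
have [mI lI] := stratonovichP SX SY ht.
have [mI1 lI1] := stratonovichP SX1 SY1 ht.
have [mI2 lI2] := stratonovichP SX2 SY2 ht.
apply: (mesh_limitD t0t _ _ _ mI mI1 mI2 lI lI1 lI2 sumE) => s;
  exact: measurable_stratonovich_sum.
Qed.

Lemma stratonovichDl X Y1 Y2 t : S X -> S Y1 -> S Y2 -> t0 <= t <= t1 ->
  {ae P, forall w, J (fun s w' => Y1 s w' + Y2 s w') X t w =
                   J Y1 X t w + J Y2 X t w}.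
Proof.
move=> SX SY1 SY2 ht; apply: stratonovich_sumD => //.
  exact: (strat_add hS).
move=> s _; apply: aeW => w; rewrite -big_split /=; apply: eq_bigr => k _.
by field.
Qed.

Lemma stratonovichDr X1 X2 Y t : S X1 -> S X2 -> S Y -> t0 <= t <= t1 ->
  {ae P, forall w, J Y (fun s w' => X1 s w' + X2 s w') t w =
                   J Y X1 t w + J Y X2 t w}.
Proof.
move=> SX1 SX2 SY ht; apply: stratonovich_sumD => //.
  exact: (strat_add hS).
move=> s _; apply: aeW => w; rewrite -big_split /=; apply: eq_bigr => k _.
by field.
Qed.

(** Additivity applied to [0 = 0 + 0] gives [J = J + J] almost surely. *)
Lemma stratonovich0l X t : S X -> t0 <= t <= t1 ->
  {ae P, forall w, J (fun _ _ => 0) X t w = 0}.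
Proof.
move=> SX ht; have := stratonovichDl SX class0 class0 ht.
by apply: filterS => w; under eq_fun do under eq_fun do rewrite addr0; lra.
Qed.

Lemma stratonovich0r Y t : S Y -> t0 <= t <= t1 ->
  {ae P, forall w, J Y (fun _ _ => 0) t w = 0}.
Proof.
move=> SY ht; have := stratonovichDr class0 class0 SY ht.
by apply: filterS => w; under eq_fun do under eq_fun do rewrite addr0; lra.
Qed.

Lemma stratonovichNl X Y t : S X -> S Y -> t0 <= t <= t1 ->
  {ae P, forall w, J (fun s w' => - Y s w') X t w = - J Y X t w}.
Proof.
move=> SX SY ht; apply: filterS2 (stratonovichDl SX SY (classN SY) ht)
  (stratonovich0l SX ht) => w.
by under eq_fun do under eq_fun do rewrite subrr; lra.
Qed.

Lemma stratonovich_suml (A : Type) (r : seq A) (Y : A -> process R T) X t :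
  S X -> (forall i, S (Y i)) -> t0 <= t <= t1 ->
  {ae P, forall w, J (fun s w' => \sum_(i <- r) Y i s w') X t w =
                   \sum_(i <- r) J (Y i) X t w}.
Proof.
move=> SX SY ht; elim: r => [|i r ih].
  apply: filterS (stratonovich0l SX ht) => w e; rewrite big_nil -[RHS]e.
  congr (J _ X t w); apply: process_ext => s w'; exact: big_nil.
apply: filterS2 ih (stratonovichDl SX (SY i) (class_sum r SY) ht) => w ih e.
rewrite big_cons -ih -e.
congr (J _ X t w); apply: process_ext => s w'; exact: big_cons.
Qed.

Lemma stratonovich_sumr (A : Type) (r : seq A) (X : A -> process R T) Y t :
  (forall i, S (X i)) -> S Y -> t0 <= t <= t1 ->
  {ae P, forall w, J Y (fun s w' => \sum_(i <- r) X i s w') t w =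
                   \sum_(i <- r) J Y (X i) t w}.
Proof.
move=> SX SY ht; elim: r => [|i r ih].
  apply: filterS (stratonovich0r SY ht) => w e; rewrite big_nil -[RHS]e.
  congr (J Y _ t w); apply: process_ext => s w'; exact: big_nil.
apply: filterS2 ih (stratonovichDr (SX i) (class_sum r SX) SY ht) => w ih e.
rewrite big_cons -ih -e.
congr (J Y _ t w); apply: process_ext => s w'; exact: big_cons.
Qed.

(* The initial values of the integrators need not agree: a random variable
   that is constant in time is not known to belong to the class. *)
Lemma ae_eq_integrator X X' Y t : S X -> S X' -> S Y ->
  (forall s, t0 <= s <= t1 ->
    {ae P, forall w, X s w - X t0 w = X' s w - X' t0 w}) ->
  t0 <= t <= t1 -> {ae P, forall w, J Y X t w = J Y X' t w}.
Proof.
move=> SX SX' SY XX' ht.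
(* A zero second summand turns the additivity principle into a comparison of two integrals. *)
have := @stratonovich_sumD X Y X' Y (fun _ _ => 0) (fun _ _ => 0) t
  SX SY SX' SY class0 class0 ht.
move=> H; have {H} : {ae P, forall w, J Y X t w =
    J Y X' t w + J (fun _ _ => 0) (fun _ _ => 0) t w}.
  apply: H => s hs.
  (* A partition has finitely many points, so one null set serves for all of them. *)
  have : {ae P, forall w, forall k : 'I_(size s).+1,
      X (pt t0 s k) w - X t0 w = X' (pt t0 s k) w - X' t0 w}.
    apply: filter_forall => k; apply: XX'.
    exact: pt_class_itv ht hs (ltn_ord k).
  apply: filterS => w hw; rewrite -big_split /=; apply: eq_bigr => k _.
  have /= hk := hw (widen_ord (leqnSn _) k).
  have /= hk1 := hw (lift ord0 k).
  rewrite addr0 mul0r mul0r addr0; congr (_ * _).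
  by rewrite /bump leq0n add1n in hk1; lra.
apply: filterS2 (stratonovich0l class0 ht) => w -> ->.
by rewrite addr0.
Qed.

(** The product rule is exact already for the sums: with midpoint averages, [(x + x') / 2 * (y' - y)
    + (y + y') / 2 * (x' - x) = x' * y' - x * y], and the right-hand sides telescope. *)
Lemma stratonovich_prod X Y t : S X -> S Y -> t0 <= t <= t1 ->
  {ae P, forall w, X t w * Y t w - X t0 w * Y t0 w = J X Y t w + J Y X t w}.
Proof.
move=> SX SY ht; have /andP[t0t tt1] := ht.
have t0t1 : t0 <= t0 <= t1 by rewrite lexx (le_trans t0t).
have [mI1 lI1] := stratonovichP SY SX ht.
have [mI2 lI2] := stratonovichP SX SY ht.
pose I w := X t w * Y t w - X t0 w * Y t0 w.
have mI : measurable_fun setT I.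
  by apply: measurable_funB; apply: measurable_funM; exact: measurable_class.
(* The increment [I] is regarded as a sum independent of the partition, which trivially converges to
   itself. *)
apply: (@mesh_limitD _ _ _ P t0 t (fun=> I) (stratonovich_sum t0 X Y)
  (stratonovich_sum t0 Y X) I) => //.
- by move=> s; exact: measurable_stratonovich_sum.
- by move=> s; exact: measurable_stratonovich_sum.
- move=> eps eta eps0 eta0; exists 1 => // s _ _.
  rewrite (_ : [set w | _] = set0) ?measure0 ?lee_fin ?ltW//.
  apply/seteqP; split=> w //=.
  by rewrite subrr normr0 leNgt eps0.
- move=> s hs; apply: aeW => w; rewrite -big_split /=.
  pose f k := X (pt t0 s k) w * Y (pt t0 s k) w.
  transitivity (\sum_(0 <= k < size s) (f k.+1 - f k)).
    by rewrite telescope_sumr// /f (pt_last hs).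
  by rewrite big_mkord; apply: eq_bigr => k _; rewrite /f; field.
Qed.

(** The product rule for [X] and the constant 1; the integral against the constant 1 vanishes, since
    this integrator has the same increments as 0. *)
Lemma stratonovich1 X t : S X -> t0 <= t <= t1 ->
  {ae P, forall w, J (fun _ _ => 1) X t w = X t w - X t0 w}.
Proof.
move=> SX ht; have S1 := strat_cst hS 1.
have : {ae P, forall w, J X (fun _ _ => 1) t w = 0}.
  apply: filterS2 (stratonovich0r SX ht)
    (@ae_eq_integrator (fun _ _ => 1) (fun _ _ => 0) X t S1 class0 SX _ ht).
    by move=> w -> ->.
  by move=> s _; apply: aeW => w; rewrite !subrr.
apply: filterS2 (stratonovich_prod SX S1 ht) => w.
by rewrite !mulr1 => -> ->; rewrite add0r.
Qed.

(** The product rule in the shape produced by [time_diff], whose integrand is 1. *)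
Lemma stratonovich1M X Y t : S X -> S Y -> t0 <= t <= t1 ->
  {ae P, forall w, J (fun _ _ => 1) (fun s w' => X s w' * Y s w') t w =
                   J X Y t w + J Y X t w}.
Proof.
move=> SX SY ht; apply: filterS2 (stratonovich_prod SX SY ht)
  (stratonovich1 (strat_mul hS SX SY) ht) => w <- ->.
by [].
Qed.

(** [strat_chain] describes the increments of [F(X)] from [t0], and an integral sees only increments
    of its integrator. So [F(X)] may be replaced by the sum of the integrals [I j], after which
    additivity and [strat_assoc] apply. *)
Lemma stratonovich_chain k (F : 'rV[R]_k -> R) (X : 'I_k -> process R T) Y t :
  smooth F -> (forall j, S (X j)) -> S Y -> t0 <= t <= t1 ->
  {ae P, forall w,
    J Y (fun s w' => F (\row_j X j s w')) t w =
    \sum_j J (fun s w' => Y s w' * 'D_('e_j) F (\row_l X l s w')) (X j) t w}.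
Proof.
move=> sF SX SY ht.
have SDF j := strat_smooth hS (smooth_partial j sF) SX.
pose I j := J (fun s w' => 'D_('e_j) F (\row_l X l s w')) (X j).
have SI j : S (I j) by exact: (strat_integral hS (SX j) (SDF j)).
have t0t1 : t0 <= t0 <= t1.
  by case/andP: ht => h1 h2; rewrite lexx (le_trans h1).
have e1 : {ae P, forall w, J Y (fun s w' => F (\row_j X j s w')) t w =
    J Y (fun s w' => \sum_j I j s w') t w}.
  apply: ae_eq_integrator => //; first exact: (strat_smooth hS sF SX).
    exact: class_sum.
  (* The chain rule at time [t0] itself shows that the sum of the [I j] vanishes there almost
     surely. *)
  move=> s hs; apply: filterS2 (strat_chain hS sF SX hs)
    (strat_chain hS sF SX t0t1) => w -> /esym.
  by rewrite subrr => ->; rewrite subr0.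
have e2 := stratonovich_sumr (index_enum _) SI SY ht.
have e3 : {ae P, forall w, forall j, J Y (I j) t w =
    J (fun s w' => Y s w' * 'D_('e_j) F (\row_l X l s w')) (X j) t w}.
  by apply: filter_forall => j; exact: (strat_assoc hS (SX j) SY (SDF j) ht).
apply: filterS3 e1 e2 e3 => w -> -> e3; exact: eq_bigr.
Qed.

End StratonovichClass.

(** * Derivatives along lines and in coordinates *)

Section Derivatives.
Context {R : realType}.

Lemma derive_row_vector k (F : 'rV[R]_k -> R) (v u : 'rV[R]_k) :
  differentiable F v -> 'D_u F v = \sum_j u 0 j * 'D_('e_j) F v.
Proof.
move=> dF; rewrite deriveE// [in LHS](row_sum_delta u) linear_sum.
by apply: eq_bigr => j _; rewrite linearZ deriveE.
Qed.

(** Identifies the difference quotient of [derive1] at [e = 0] along a line with the one defining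
    ['D_u F v]; both the value and the derivability of the restriction to the line follow. *)
Lemma line_quotient k (F : 'rV[R]_k -> R) (v u : 'rV[R]_k) :
  (fun h : R => h^-1 *: (F (v + (h + 0) *: u) - F (v + 0 *: u))) =
  (fun h : R => h^-1 *: ((F \o shift v) (h *: u) - F v)).
Proof. by apply/funext => h /=; rewrite addr0 scale0r addr0 [v + _]addrC. Qed.

Lemma derive1_line k (F : 'rV[R]_k -> R) (v u : 'rV[R]_k) :
  derive1 (fun e : R => F (v + e *: u)) 0 = 'D_u F v.
Proof. by rewrite /derive1 line_quotient. Qed.

Lemma derivable_line k (F : 'rV[R]_k -> R) (v u : 'rV[R]_k) :
  differentiable F v -> derivable (fun e : R => F (v + e *: u)) 0 1.
Proof.
move=> dF; have : derivable F v u by exact: diff_derivable.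
rewrite /derivable -line_quotient.
by under [in X in _ -> X]eq_fun do rewrite /= [_ *: 1]mulr1.
Qed.

Lemma is_derive_affine (c k : R) :
  is_derive (0 : R) (1 : R) (fun e : R => c + e * k) k.
Proof.
have h := is_deriveD (is_derive_cst c (0 : R) (1 : R))
  (is_deriveM (is_derive_id (0 : R) (1 : R)) (is_derive_cst k (0 : R) (1 : R))).
move: h; rewrite scaler0 !add0r.
by rewrite [_ *: _]mulr1 => h; exact: h.
Qed.

Lemma derive1_affine (c k : R) : derive1 (fun e : R => c + e * k) 0 = k.
Proof. by rewrite derive1E; case: (is_derive_affine c k). Qed.

(** The second factor is the shape of a jet evaluated at [z + e *: zeta]. *)
Lemma derive1_mul_affine (f : R -> R) (c k : R) : derivable f 0 1 ->
  derive1 (fun e : R => f e * (c + e * k)) 0 = derive1 f 0 * c + f 0 * k.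
Proof.
move=> df; have [dg gE] := is_derive_affine c k.
rewrite !derive1E.
have := deriveM df dg; rewrite gE mul0r addr0 => E.
by rewrite [LHS]E addrC [c *: _]mulrC.
Qed.

Lemma derive_comp_row_vector n m (F : 'rV[R]_m -> R) (g : 'rV[R]_n -> 'rV[R]_m)
    (x u : 'rV[R]_n) :
  differentiable F (g x) -> differentiable g x ->
  'D_u (fun y => F (g y)) x =
  \sum_b 'D_u (fun y => g y 0 b) x * 'D_('e_b) F (g x).
Proof.
move=> dF dg.
rewrite deriveE; last exact: differentiable_comp.
rewrite diff_comp//= -!deriveE// derive_row_vector//.
by apply: eq_bigr => b _; rewrite derive_mx ?mxE//; exact: diff_derivable.
Qed.

End Derivatives.

(** * Variations and total derivatives of functionals of the field *)

Section FieldDerivatives.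
Context {R : realType} {d : measure_display} {T : measurableType d}.
Context {n m : nat}.
Implicit Types (z zeta : field R T n m) (F : 'rV[R]_m -> R).
Implicit Types (A : 'I_m -> 'rV[R]_m -> R) (t : R).

Lemma differentiable_component z x t w a :
  differentiable (fun y => z y t w) x ->
  differentiable (fun y => z y t w 0 a) x.
Proof.
move=> dz.
exact: (differentiable_comp dz (differentiable_coord (z x t w) 0 a)).
Qed.

Lemma vd_component a z zeta : vd (component a) z zeta = component a zeta.
Proof.
apply/funext => x; apply: process_ext => t w; rewrite /vd /component.
under eq_fun do rewrite !mxE.
exact: derive1_affine.
Qed.

Lemma vd_fconst (X : process R T) z zeta x :
  vd (fconst X) z zeta x = fun _ _ => 0.
Proof. by apply: process_ext => t w; rewrite /vd derive1_cst. Qed.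

Lemma total_deriv_const (X : process R T) (i : 'I_n) x :
  total_deriv i (const_field X) x = fun _ _ => 0.
Proof. by apply: process_ext => t w; rewrite /total_deriv derive_cst. Qed.

Lemma vd_subst F z zeta x : (forall v, differentiable F v) ->
  vd (subst F) z zeta x =
  fun t w => \sum_b component b zeta x t w *
                    subst (fun v => 'D_('e_b) F v) z x t w.
Proof.
move=> dF; apply: process_ext => t w.
by rewrite /vd /subst derive1_line derive_row_vector.
Qed.

Lemma vd_fopp F z zeta x : (forall v, differentiable F v) ->
  vd (fopp (subst F)) z zeta x =
  fun t w => - \sum_b component b zeta x t w *
                    subst (fun v => 'D_('e_b) F v) z x t w.
Proof.
move=> dF; apply: process_ext => t w; have := vd_subst z zeta x dF.
move=> /(congr1 (fun X : process R T => X t w)) <-.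
have /deriveN := @derivable_line R m F _ (zeta x t w) (dF (z x t w)).
by rewrite -!derive1E => E; exact: E.
Qed.

(** By linearity of the spatial derivative, a jet is affine in [e] along a variation. *)
Lemma jet_line z zeta x t w i a (e : R) :
  differentiable (fun y => z y t w) x ->
  differentiable (fun y => zeta y t w) x ->
  jet i a (fun y s w' => z y s w' + e *: zeta y s w') x t w =
  jet i a z x t w + e * jet i a zeta x t w.
Proof.
move=> /(differentiable_component a) dz /(differentiable_component a) dzeta.
have {}dz : derivable (fun y => z y t w 0 a) x 'e_i by exact: diff_derivable.
have {}dzeta : derivable (fun y => zeta y t w 0 a) x 'e_i.
  exact: diff_derivable.
rewrite /jet /total_deriv /component.
under eq_fun do rewrite !mxE.
have dezeta := @derivableZ _ _ _ _ e _ _ dzeta.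
have := deriveD dz dezeta; rewrite (deriveZ e dzeta) => E.
exact: E.
Qed.

Lemma vd_fmul_jet F z zeta x t w i a : (forall v, differentiable F v) ->
  differentiable (fun y => z y t w) x ->
  differentiable (fun y => zeta y t w) x ->
  vd (fmul (subst F) (jet i a)) z zeta x t w =
  (\sum_b component b zeta x t w * subst (fun v => 'D_('e_b) F v) z x t w) *
    jet i a z x t w + subst F z x t w * jet i a zeta x t w.
Proof.
move=> dF dz dzeta; have := vd_subst z zeta x dF.
move=> /(congr1 (fun X : process R T => X t w)) <-.
rewrite /vd /fmul /subst.
under eq_fun do rewrite jet_line//.
rewrite derive1_mul_affine; last exact: derivable_line.
by rewrite scale0r addr0.
Qed.

Lemma canonical_formE A z zeta x :
  canonical_form A z zeta x =
  fun t w => \sum_a subst (A a) z x t w * component a zeta x t w.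
Proof.
by apply: process_ext => t w; apply: eq_bigr => a _; rewrite vd_component.
Qed.

(** Leibniz rule in space for the products of [A a] along [z] with the components of [zeta], the
    chain rule being used on the first factor. *)
Lemma total_deriv_canonical_form A z zeta x t w i :
  (forall a v, differentiable (A a) v) ->
  differentiable (fun y => z y t w) x ->
  differentiable (fun y => zeta y t w) x ->
  total_deriv i (canonical_form A z zeta) x t w =
  \sum_a ((\sum_b jet i b z x t w *
             subst (fun v => 'D_('e_b) (A a) v) z x t w) *
      component a zeta x t w + subst (A a) z x t w * jet i a zeta x t w).
Proof.
move=> dA dz dzeta; rewrite /total_deriv.
under eq_fun do rewrite canonical_formE.
have dAz a : differentiable (fun y => A a (z y t w)) x.
  exact: (differentiable_comp dz (dA a (z x t w))).
have dc a : differentiable (fun y => zeta y t w 0 a) x.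
  exact: differentiable_component.
have -> : (fun y => \sum_a subst (A a) z y t w * component a zeta y t w) =
    \sum_a ((fun y => A a (z y t w)) * (fun y => zeta y t w 0 a)).
  by apply/funext => y; rewrite fct_sumE.
rewrite derive_sum => [|a]; last first.
  by apply: diff_derivable; exact: differentiableM.
apply: eq_bigr => a _.
rewrite deriveM; [|exact: diff_derivable..].
rewrite derive_comp_row_vector//= addrC; congr (_ + _).
by rewrite mulrC.
Qed.

End FieldDerivatives.

(** The pointwise core of the law, with [D b a] for the derivative of [A a] along ['e_b], [u] for
    [zeta] and [v] for a spatial derivative of [z]. The terms in [D b a * v b * u a] cancel, and
    exchanging the two indices identifies what is left. *)
Lemma curl_pairing (R : comNzRingType) m (D : 'I_m -> 'I_m -> R)
    (u v l : 'I_m -> R) :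
  \sum_a ((\sum_b v b * D b a) * u a + l a) +
    \sum_a \sum_b u a * ((D a b - D b a) * v b) =
  \sum_a ((\sum_b u b * D b a) * v a + l a).
Proof.
rewrite !big_split /= addrAC; congr (_ + _).
under eq_bigr do rewrite mulr_suml.
under [in RHS]eq_bigr do rewrite mulr_suml.
rewrite [RHS]exchange_big -big_split /=; apply: eq_bigr => a _.
by rewrite -big_split /=; apply: eq_bigr => b _; ring.
Qed.

(** * Sums over formal differentials *)

Section FormalSums.
Context {A : Type} {V : nmodType}.
Implicit Types f : A * A -> V.

Lemma sum_dsum k (E : 'I_k -> sdiff A) f :
  \sum_(p <- \dsum_(i < k) E i) f p = \sum_(i < k) \sum_(p <- E i) f p.
Proof.
apply: (big_morph (fun D : sdiff A => \sum_(p <- D) f p)) => [D D'|].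
  exact: big_cat.
exact: big_nil.
Qed.

Lemma sum_dsum_od k (F G : 'I_k -> A) f :
  \sum_(p <- \dsum_(i < k) (F i \od G i)) f p = \sum_(i < k) f (F i, G i).
Proof. by rewrite sum_dsum; apply: eq_bigr => i _; rewrite big_seq1. Qed.

Lemma sum_dsum2_od k l (F G : 'I_k -> 'I_l -> A) f :
  \sum_(p <- \dsum_(i < k) \dsum_(j < l) (F i j \od G i j)) f p =
  \sum_(i < k) \sum_(j < l) f (F i j, G i j).
Proof. by rewrite sum_dsum; apply: eq_bigr => i _; rewrite sum_dsum_od. Qed.

End FormalSums.

(** * Multiplying an identity of differentials by a process *)

Section QuasiConservation.
Context {R : realType} {d : measure_display} {T : measurableType d} {n m : nat}.
Variables (P : probability T R) (t0 t1 : R) (W : process R T).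
Variable S : set (process R T).
Hypothesis hS : stratonovich_class P t0 t1 W S.
Variable z : field R T n m.
Hypothesis hz : admissible t0 t1 S z.
Variable x : 'rV[R]_n.

Local Notation J := (stratonovich P t0).

Lemma class_component a : S (component a z x).
Proof. by have [_ /(_ x a)[]] := hz. Qed.

Lemma class_jet i a : S (jet i a z x).
Proof. by have [_ /(_ x a)[]] := hz. Qed.

Lemma subst_row_vector F :
  subst F z x = fun t w => F (\row_j component j z x t w).
Proof.
apply: process_ext => t w; congr F.
by apply/rowP => j; rewrite mxE.
Qed.

Lemma class_subst F : smooth F -> S (subst F z x).
Proof.
move=> sF; rewrite subst_row_vector.
exact: (strat_smooth hS sF class_component).
Qed.

Lemma class_subst_curl (A : 'I_m -> 'rV[R]_m -> R) a b :
  (forall c, smooth (A c)) -> S (subst (curl A a b) z x).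
Proof.
move=> sA.
have SD e c : S (subst (fun v => 'D_('e_e) (A c) v) z x).
  by apply: class_subst; exact: smooth_partial.
exact: (classB hS (SD a b) (SD b a)).
Qed.

Lemma stratonovich_subst F Y t : smooth F -> S Y -> t0 <= t <= t1 ->
  {ae P, forall w, J Y (subst F z x) t w =
    \sum_j J (fun s w' => Y s w' * subst (fun v => 'D_('e_j) F v) z x s w')
             (component j z x) t w}.
Proof.
move=> sF SY ht.
apply: filterS (stratonovich_chain hS sF class_component SY ht) => w.
rewrite subst_row_vector => ->; apply: eq_bigr => j _.
by rewrite subst_row_vector.
Qed.

(** Ensures that every term of [Theta] can be integrated at [z] and [x], and that the resulting
    process can in turn serve as an integrator. *)
Fixpoint class_sdiff (Theta : sdiff (@functional R d T n m)) : Prop :=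
  if Theta is p :: Theta' then
    [/\ S (p.1 z x), S (p.2 z x) & class_sdiff Theta']
  else True.

Lemma class_sdiff_cat Theta Theta' :
  class_sdiff Theta -> class_sdiff Theta' -> class_sdiff (Theta ++ Theta').
Proof. by elim: Theta => //= p Theta ih [? ? ?] ?; split=> //; exact: ih. Qed.

Lemma class_sdiff_dsum k (E : 'I_k -> sdiff functional) :
  (forall i, class_sdiff (E i)) -> class_sdiff (\dsum_(i < k) E i).
Proof.
by move=> hE; elim/big_rec: _ => // i D _ hD; exact: class_sdiff_cat.
Qed.

(** Additivity in the integrator and [strat_assoc], term by term. Membership of the integral in [S]
    is carried along, as the induction needs it to add one more term. *)
Lemma stratonovich_integrate Theta Z t : class_sdiff Theta -> S Z ->
  t0 <= t <= t1 ->
  S (integrate P t0 (eval_sdiff Theta z) x) /\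
  {ae P, forall w, J Z (integrate P t0 (eval_sdiff Theta z) x) t w =
    \sum_(p <- Theta) J (fun s w' => Z s w' * p.1 z x s w') (p.2 z x) t w}.
Proof.
move=> + SZ ht; elim: Theta => [_|p Theta ih [S1 S2 /ih{ih}[SI eI]]].
  have -> : integrate P t0 (eval_sdiff [::] z) x = fun _ _ => 0.
    by apply: process_ext => t' w; exact: big_nil.
  split; first exact: class0 hS.
  by apply: filterS (stratonovich0r hS SZ ht) => w ->; rewrite big_nil.
set I := integrate _ _ _ _ in SI eI.
have -> : integrate P t0 (eval_sdiff (p :: Theta) z) x =
    fun s w => J (p.1 z x) (p.2 z x) s w + I s w.
  by apply: process_ext => t' w; exact: big_cons.
have SJ := strat_integral hS S2 S1.
split; first exact: (strat_add hS SJ SI).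
apply: filterS3 eI (stratonovichDr hS SJ SI SZ ht)
  (strat_assoc hS S2 SZ S1 ht) => w eI -> ->.
by rewrite big_cons eI.
Qed.

(** The equations are known only in integrated form. Integrating [Z] against both sides, seen as
    integrators, multiplies them by [Z]. *)
Lemma stratonovich_mul_sdiff Theta Theta' Z t :
  class_sdiff Theta -> class_sdiff Theta' -> S Z ->
  (forall s, t0 <= s <= t1 -> {ae P, forall w,
     integrate P t0 (eval_sdiff Theta z) x s w =
     integrate P t0 (eval_sdiff Theta' z) x s w}) ->
  t0 <= t <= t1 ->
  {ae P, forall w,
    \sum_(p <- Theta) J (fun s w' => Z s w' * p.1 z x s w') (p.2 z x) t w =
    \sum_(p <- Theta') J (fun s w' => Z s w' * p.1 z x s w') (p.2 z x) t w}.
Proof.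
move=> cT cT' SZ eqT ht.
have [SI eI] := stratonovich_integrate cT SZ ht.
have [SI' eI'] := stratonovich_integrate cT' SZ ht.
have t0t1 : t0 <= t0 <= t1.
  by case/andP: ht => h1 h2; rewrite lexx (le_trans h1).
apply: filterS3 eI eI' (ae_eq_integrator hS SI SI' SZ _ ht).
  by move=> w <- <-.
move=> s hs.
by apply: filterS2 (eqT s hs) (eqT t0 t0t1) => w -> ->.
Qed.

End QuasiConservation.

(** * The Hamiltonian, time and flux terms of the law *)

Section Parts.
Context {R : realType} {d : measure_display} {T : measurableType d} {n m : nat}.
Variables (P : probability T R) (t0 t1 : R) (W : process R T).
Variable S : set (process R T).
Hypothesis hS : stratonovich_class P t0 t1 W S.
Variables z zeta : field R T n m.
Hypothesis hz : admissible t0 t1 S z.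
Hypothesis hzeta : admissible t0 t1 S zeta.
Variable x : 'rV[R]_n.

Local Notation J := (stratonovich P t0).

Lemma vd_hamiltonian H X t : smooth H -> S X -> t0 <= t <= t1 ->
  {ae P, forall w, J (vd (fopp (subst H)) z zeta x) X t w =
    - \sum_a J (fun s w' => component a zeta x s w' *
                  subst (fun v => 'D_('e_a) H v) z x s w') X t w}.
Proof.
move=> sH SX ht.
have SH a : S (fun s w' => component a zeta x s w' *
    subst (fun v => 'D_('e_a) H v) z x s w').
  apply: (strat_mul hS (class_component hzeta x a)).
  apply: (class_subst hS hz); exact: smooth_partial.
rewrite vd_fopp => [|v]; last exact: smooth_differentiable.
apply: filterS2 (stratonovichNl hS SX (class_sum hS (index_enum 'I_m) SH) ht)
  (stratonovich_suml hS (index_enum 'I_m) SX SH ht) => w -> ->.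
by [].
Qed.

(** The product rule splits the differential of the canonical form into the [A a] integrated against
    [zeta] and [zeta] integrated against the [A a]; the chain rule expands the latter over the
    drivers [component b z]. Adding the curl exchanges the two indices of the derivative, which
    produces the variation of [A b]. *)
Lemma time_part (A : 'I_m -> 'rV[R]_m -> R) t :
  (forall a, smooth (A a)) -> t0 <= t <= t1 ->
  {ae P, forall w,
    J (fun _ _ => 1) (canonical_form A z zeta x) t w +
    \sum_a \sum_b J (fun s w' => component a zeta x s w' *
                       subst (curl A a b) z x s w') (component b z x) t w =
    \sum_a (J (vd (subst (A a)) z zeta x) (component a z x) t w +
            J (subst (A a) z x) (component a zeta x) t w)}.
Proof.
move=> sA ht.
have Sz := class_component hz x; have Szeta := class_component hzeta x.
have SA a := class_subst hS hz x (sA a).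
have S1 := strat_cst hS 1.
pose D a b s w' := component a zeta x s w' *
  subst (fun v => 'D_('e_b) (A a) v) z x s w'.
pose C a b s w' := component a zeta x s w' * subst (curl A a b) z x s w'.
have SD a b : S (D a b).
  apply: (strat_mul hS (Szeta a)); apply: (class_subst hS hz).
  exact: smooth_partial.
have SC a b : S (C a b).
  by apply: (strat_mul hS (Szeta a)); apply: (class_subst_curl hS hz).
have e1 := stratonovich_sumr hS (index_enum 'I_m)
  (fun a => strat_mul hS (SA a) (Szeta a)) S1 ht.
have e2 : {ae P, forall w, forall a, J (fun _ _ => 1)
    (fun s w' => subst (A a) z x s w' * component a zeta x s w') t w =
    J (subst (A a) z x) (component a zeta x) t w +
    J (component a zeta x) (subst (A a) z x) t w}.
  by apply: filter_forall => a; exact: (stratonovich1M hS).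
have e3 : {ae P, forall w, forall a,
    J (component a zeta x) (subst (A a) z x) t w =
    \sum_b J (D a b) (component b z x) t w}.
  by apply: filter_forall => a; exact: (stratonovich_subst hS hz).
(* [D a b + C a b] is [zeta] in component [a] times the derivative of [A b] along ['e_a], so its sum
   over [a] is the variation of [A b]. *)
have e4 : {ae P, forall w, forall b,
    J (vd (subst (A b)) z zeta x) (component b z x) t w =
    \sum_a J (D a b) (component b z x) t w +
    \sum_a J (C a b) (component b z x) t w}.
  apply: filter_forall => b.
  have -> : vd (subst (A b)) z zeta x =
      fun s w' => \sum_a D a b s w' + \sum_a C a b s w'.
    rewrite vd_subst => [|v]; last exact: smooth_differentiable.
    apply: process_ext => s w'; rewrite -big_split /=; apply: eq_bigr => a _.
    by rewrite /D /C /subst /curl; ring.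
  have SDb := class_sum hS (index_enum 'I_m) (SD^~ b).
  have SCb := class_sum hS (index_enum 'I_m) (SC^~ b).
  apply: filterS3 (stratonovichDl hS (Sz b) SDb SCb ht)
    (stratonovich_suml hS (index_enum 'I_m) (Sz b) (SD^~ b) ht)
    (stratonovich_suml hS (index_enum 'I_m) (Sz b) (SC^~ b) ht) => w.
  by move=> -> -> ->.
rewrite canonical_formE.
apply: filterS2 (filterI e1 e2) (filterI e3 e4) => w [-> {}e2] [{}e3 {}e4].
under eq_bigr do rewrite e2 e3.
under [in RHS]eq_bigr do rewrite e4.
(* Only the order of the double sums over [a] and [b], and of the summands, remains to be
   matched. *)
rewrite !big_split /= [X in _ + X + _ = _]exchange_big.
rewrite [X in _ + X = _]exchange_big /=.
by rewrite addrC addrCA addrA addrAC [X in X + _ = _]addrC addrAC.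
Qed.

(** All integrals have the same integrator [X], so linearity in the integrand reduces the claim to
    [curl_pairing] at each time and sample point. *)
Lemma flux_part (A : 'I_m -> 'rV[R]_m -> R) (i : 'I_n) X t :
  (forall a, smooth (A a)) -> S X -> t0 <= t <= t1 ->
  {ae P, forall w,
    J (total_deriv i (canonical_form A z zeta) x) X t w +
    \sum_a \sum_b J (fun s w' => component a zeta x s w' *
      fmul (subst (curl A a b)) (jet i b) z x s w') X t w =
    \sum_a J (vd (fmul (subst (A a)) (jet i a)) z zeta x) X t w}.
Proof.
move=> sA SX ht.
have dA a v := smooth_differentiable v (sA a).
have Szeta := class_component hzeta x.
have Sj := class_jet hz x i; have Sjzeta := class_jet hzeta x i.
have SA a := class_subst hS hz x (sA a).
have SdA a b := class_subst hS hz x (smooth_partial b (sA a)).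
pose D s w' := \sum_a ((\sum_b jet i b z x s w' *
    subst (fun v => 'D_('e_b) (A a) v) z x s w') * component a zeta x s w' +
    subst (A a) z x s w' * jet i a zeta x s w').
pose C a b s w' := component a zeta x s w' *
  fmul (subst (curl A a b)) (jet i b) z x s w'.
pose B a s w' := (\sum_b component b zeta x s w' *
    subst (fun v => 'D_('e_b) (A a) v) z x s w') * jet i a z x s w' +
    subst (A a) z x s w' * jet i a zeta x s w'.
have SD : S D.
  apply: (class_sum hS) => a; apply: (strat_add hS); last exact: (strat_mul hS).
  apply: (strat_mul hS) => //; apply: (class_sum hS) => b.
  exact: (strat_mul hS).
have SC a b : S (C a b).
  apply: (strat_mul hS) => //; apply: (strat_mul hS) => //.
  exact: (class_subst_curl hS hz).
have SB a : S (B a).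
  apply: (strat_add hS); last exact: (strat_mul hS).
  apply: (strat_mul hS) => //; apply: (class_sum hS) => b.
  exact: (strat_mul hS).
have SCs a := class_sum hS (index_enum 'I_m) (SC a).
(* The explicit formulas hold at times in [[t0, t1]], where [z] and [zeta] are differentiable in
   space; the integrals still coincide. *)
have e0 : J (total_deriv i (canonical_form A z zeta) x) X t = J D X t.
  apply: (eq_stratonovich P _ _ ht) => // s w hs.
  by rewrite total_deriv_canonical_form//; [apply: hz.1|apply: hzeta.1].
have e1 a : J (vd (fmul (subst (A a)) (jet i a)) z zeta x) X t = J (B a) X t.
  apply: (eq_stratonovich P _ _ ht) => // s w hs.
  by rewrite vd_fmul_jet//; [apply: hz.1|apply: hzeta.1].
have e2 : {ae P, forall w, forall a, J (fun s w' => \sum_b C a b s w') X t w =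
    \sum_b J (C a b) X t w}.
  by apply: filter_forall => a; exact: (stratonovich_suml hS).
have e3 := stratonovich_suml hS (index_enum 'I_m) SX SCs ht.
have e4 := stratonovichDl hS SX SD (class_sum hS (index_enum 'I_m) SCs) ht.
have e5 := stratonovich_suml hS (index_enum 'I_m) SX SB ht.
apply: filterS2 (filterI e2 e3) (filterI e4 e5) => w [{}e2 {}e3] [{}e4 {}e5].
transitivity (J D X t w + J (fun s w' => \sum_a \sum_b C a b s w') X t w).
  rewrite e0 e3; congr (_ + _); apply: eq_bigr => a _.
  exact (esym (e2 a)).
transitivity (J (fun s w' => \sum_a B a s w') X t w); last first.
  by rewrite e5; apply: eq_bigr => a _; rewrite e1.
rewrite -e4; congr (J _ X t w); apply: process_ext => s w'.
exact: (curl_pairing (fun b a => subst (fun v => 'D_('e_b) (A a) v) z x s w')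
  (fun a => component a zeta x s w') (fun b => jet i b z x s w')).
Qed.

End Parts.

(** * The quasi-conservation law *)

Theorem mainTheorem1 (R : realType) (d : measure_display)
    (T : measurableType d) (P : probability T R) (n m : nat)
    (t0 t1 : R) (W : process R T) (S : set (process R T))
    (L0 : 'I_m -> 'rV[R]_m -> R) (L Lt : 'I_n -> 'I_m -> 'rV[R]_m -> R)
    (H Ht : 'rV[R]_m -> R)
    (ht0 : 0 <= t0) (ht01 : t0 < t1)
    (hW : brownian_motion P W)
    (hS : stratonovich_class P t0 t1 W S)
    (hL0 : forall a, smooth (L0 a))
    (hL : forall i a, smooth (L i a))
    (hLt : forall i a, smooth (Lt i a))
    (hH : smooth H) (hHt : smooth Ht)
    (z : field R T n m)
    (hz : admissible t0 t1 S z)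
    (hsys : multisymplectic_system P t0 t1 W L0 L Lt H Ht z) :
  quasi_conservation_law P t0 t1 W L0 L Lt H Ht S z.
Proof.
move=> zeta hzeta x t ht.
have Stime := strat_time hS; have SW := strat_brownian hS.
have Szeta := class_component hzeta x.
have Sz F : smooth F -> S (subst F z x) by exact: (class_subst hS hz).
have Scf A : (forall a, smooth (A a)) -> S (canonical_form A z zeta x).
  move=> sA; rewrite canonical_formE; apply: (class_sum hS) => a.
  by apply: (strat_mul hS) => //; exact: Sz.
(* Equation [a] of the system, multiplied by component [a] of [zeta]; the sum over [a] is taken at
   the end. *)
have system a : {ae P, forall w,
    \sum_b stratonovich P t0 (fun s w' => component a zeta x s w' *
      subst (curl L0 a b) z x s w') (component b z x) t w +
    (\sum_i \sum_b stratonovich P t0 (fun s w' => component a zeta x s w' *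
       fmul (subst (curl (L i) a b)) (jet i b) z x s w') time_process t w +
     \sum_i \sum_b stratonovich P t0 (fun s w' => component a zeta x s w' *
       fmul (subst (curl (Lt i) a b)) (jet i b) z x s w') W t w) =
    stratonovich P t0 (fun s w' => component a zeta x s w' *
      subst (fun v => 'D_('e_a) H v) z x s w') time_process t w +
    stratonovich P t0 (fun s w' => component a zeta x s w' *
      subst (fun v => 'D_('e_a) Ht v) z x s w') W t w}.
  have := @stratonovich_mul_sdiff _ _ _ _ _ P t0 t1 W S hS z x
    (multisymplectic_lhs W L0 L Lt a) (multisymplectic_rhs W H Ht a)
    (component a zeta x) t _ _ (Szeta a) (hsys a x) ht.
  move=> e; apply: filterS (e _ _) => [w||].
  - rewrite /multisymplectic_lhs /multisymplectic_rhs !big_cat /= !big_seq1.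
    by rewrite sum_dsum_od !sum_dsum2_od.
  - apply: class_sdiff_cat; last apply: class_sdiff_cat.
    + apply: class_sdiff_dsum => b; split=> //; last first.
        exact: (class_component hz).
      exact: (class_subst_curl hS hz).
    + apply: class_sdiff_dsum => i; apply: class_sdiff_dsum => b; split=> //.
      apply: (strat_mul hS); last exact: (class_jet hz).
      exact: (class_subst_curl hS hz).
    + apply: class_sdiff_dsum => i; apply: class_sdiff_dsum => b; split=> //.
      apply: (strat_mul hS); last exact: (class_jet hz).
      exact: (class_subst_curl hS hz).
  - by split; last split=> //; try apply: Sz; try exact: smooth_partial.
(* The indices range over finite sets, so each family of almost sure identities holds outside one
   null set. *)
have {}system : {ae P, forall w, forall a, _} :=
  filter_forall (ae_filter_ringOfSetsType P) system.
have flux_time : {ae P, forall w, forall i, _} :=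
  filter_forall (ae_filter_ringOfSetsType P)
    (fun i => flux_part hS hz hzeta x i (hL i) Stime ht).
have flux_W : {ae P, forall w, forall i, _} :=
  filter_forall (ae_filter_ringOfSetsType P)
    (fun i => flux_part hS hz hzeta x i (hLt i) SW ht).
have time := time_part hS hz hzeta x hL0 ht.
have ham := vd_hamiltonian hS hz hzeta x hH Stime ht.
have hamt := vd_hamiltonian hS hz hzeta x hHt SW ht.
(* Time and [W] have zero spatial derivative and zero variation, so the Leibniz expansions contain
   integrals against 0. The next three facts remove them. *)
have cf0 A : (forall i a, smooth (A i a)) ->
    {ae P, forall w, forall i : 'I_n, stratonovich P t0
       (canonical_form (A i) z zeta x) (fun _ _ => 0) t w = 0}.
  move=> sA; apply: filter_forall => i; apply: (stratonovich0r hS) => //.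
  exact: Scf.
have jet0 A : (forall i a, smooth (A i a)) ->
    {ae P, forall w, forall (i : 'I_n) (a : 'I_m), stratonovich P t0
       (fmul (subst (A i a)) (jet i a) z x) (fun _ _ => 0) t w = 0}.
  move=> sA; apply: filter_forall => i; apply: filter_forall => a.
  apply: (stratonovich0r hS) => //; apply: (strat_mul hS); first exact: Sz.
  exact: (class_jet hz).
have ham0 F : smooth F -> {ae P, forall w, stratonovich P t0
    (fopp (subst F) z x) (fun _ _ => 0) t w = 0}.
  move=> sF; apply: (stratonovich0r hS) => //.
  by apply: (classN hS); exact: Sz.
apply: filterS3 (filterI system (filterI flux_time flux_W))
  (filterI time (filterI ham hamt))
  (filterI (filterI (cf0 L hL) (cf0 Lt hLt))
     (filterI (filterI (jet0 L hL) (jet0 Lt hLt))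
       (filterI (ham0 H hH) (ham0 Ht hHt)))) => w.
move=> [{}system [{}flux_time {}flux_W]] [{}time [{}ham {}hamt]].
move=> [[cfL cfLt] [[jetL jetLt] [hamH hamHt]]].
(* From here on [w] is fixed outside all the null sets, and both sides are expanded into finite sums
   of real numbers. *)
rewrite /integrate big_cons sum_dsum.
rewrite /vd_sdiff big_flatten big_map /= /lagrangian !big_cat /=.
rewrite sum_dsum_od !sum_dsum2_od !big_seq1 !big_cons !big_nil /=.
rewrite !vd_fconst hamH hamHt ham hamt !addr0.
under [X in _ + X = _]eq_bigr do
  rewrite !big_cons big_nil /= !total_deriv_const cfL cfLt !addr0 add0r.
under [X in _ = X + _]eq_bigr do
  rewrite !big_cons big_nil /= vd_component addr0.
under [X in _ = _ + (X + _)]eq_bigr do under eq_bigr do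
  rewrite !big_cons big_nil /= vd_fconst jetL !addr0.
under [X in _ = _ + (_ + (X + _))]eq_bigr do under eq_bigr do
  rewrite !big_cons big_nil /= vd_fconst jetLt !addr0.
rewrite -time.
rewrite /const_field /fconst.
(* The flux identities are summed over [i], and the sum over [a] is moved outermost to agree with
   the contracted system. *)
have sum_time := congr1 (fun f : 'I_n -> R => \sum_i f i) (funext flux_time).
rewrite /= big_split /= [X in _ + X = _]exchange_big /= in sum_time.
have sum_W := congr1 (fun f : 'I_n -> R => \sum_i f i) (funext flux_W).
rewrite /= big_split /= [X in _ + X = _]exchange_big /= in sum_W.
have := congr1 (fun f : 'I_m -> R => \sum_i f i) (funext system).
(* The curl sums equal the Hamiltonian sums by the contracted system, which is linear arithmetic in
   the remaining integrals. *)
rewrite /= !big_split /= -sum_time -sum_W; clear; lra.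
Qed.
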